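(* For every odd integer $r\ge3$, the grid $r$-graph $G_r$ is not common.
   Context: $G_r$ is the $r$-uniform hypergraph whose vertices are the $r^2$ points of the $r\times r$ grid and whose $2r$ edges are the sets of points on each of the $r$ horizontal lines and $r$ vertical lines of the grid. For an $r$-graph $H$ and a symmetric measurable $W:[0,1]^r\to[0,1]$ (an $r$-graphon), $t_H(W)=\int_{[0,1]^{V(H)}}\prod_{\{u_1,\dots,u_r\}\in E(H)}W(x_{u_1},\dots,x_{u_r})\,dx$. $H$ is common if $t_H(W)+t_H(1-W)\ge 2^{1-\mathrm{e}(H)}$ for every $r$-graphon $W$, where $\mathrm{e}(H)$ is the number of edges. *)

(* Defs.v *)
From HB Require Import structures.
From mathcomp Require Import all_boot all_order all_algebra.
From mathcomp Require Import all_fingroup.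
From mathcomp Require Import all_classical all_reals all_analysis.

Set Implicit Arguments.
Unset Strict Implicit.
Unset Printing Implicit Defensive.

Import Order.TTheory GRing.Theory Num.Theory.
Import numFieldNormedType.Exports.

Local Open Scope classical_set_scope.
Local Open Scope ring_scope.

Section tuple_cons.
Context d (T : measurableType d) (n : nat).

Definition tuple_cons (p : T * n.-tuple T) : n.+1.-tuple T :=
  [tuple of p.1 :: p.2].

Lemma measurable_tuple_cons : measurable_fun [set: T * n.-tuple T] tuple_cons.
Proof. exact: measurable_cons measurable_fst measurable_snd. Qed.

HB.instance Definition _ :=
  isMeasurableFun.Build _ _ _ _ tuple_cons measurable_tuple_cons.

End tuple_cons.

Section power_measure.
Context d (T : measurableType d) (R : realType) (P : probability T R).

(* The n-fold product measure of P, transported from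
   T * (T * ... * (T * unit)) to n.-tuple T. *)
Fixpoint power_measure n : probability (n.-tuple T) R :=
  if n is m.+1 then
    distribution (P \x power_measure m)%E (@tuple_cons d T m)
  else \d_ [tuple].

Lemma power_measure_box n (A : 'I_n -> set T) :
  (forall i, measurable (A i)) ->
  power_measure n [set x | forall i, A i (tnth x i)] = (\prod_(i < n) P (A i))%E.
Proof.
elim: n A => [|n IH] A mA.
  rewrite big_ord0 /= diracE mem_set //.
  by case.
rewrite big_ord_recl /= /distribution /pushforward.
pose B := [set x : n.-tuple T | forall i, A (lift ord0 i) (tnth x i)].
have mB : measurable B.
  rewrite (_ : B = \bigcap_(i in [set: 'I_n]) [set x | A (lift ord0 i) (tnth x i)]).
    apply: fin_bigcap_measurable => [|i _]; first exact: finite_finset.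
    have := @measurable_tnth _ T n i measurableT _ (mA (lift ord0 i)).
    by rewrite setTI.
  by apply/seteqP; split=> x h i //=; exact: h.
rewrite (_ : _ @^-1` _ = A ord0 `*` B).
  by rewrite product_measure1E// -(IH (fun i => A (lift ord0 i))).
apply/seteqP; split=> [[x t] /= h|[x t] /= [h0 h] i].
  split; first exact: (h ord0).
  by move=> i /=; have := h (lift ord0 i); rewrite /tuple_cons tnthS.
have [j ->|->] := unliftP ord0 i; last by [].
by rewrite /tuple_cons tnthS; exact: h.
Qed.

End power_measure.

Section unit_cube.
Variable R : realType.

Definition unit_cube n : set (n.-tuple R) :=
  [set x | forall i, 0 <= tnth x i <= 1].

(* The uniform probability on `[0, 1] is the Lebesgue measure restricted to
   `[0, 1], so this is the Lebesgue measure of the unit cube. *)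
Definition cube_measure n : probability (n.-tuple (measurableTypeR R)) R :=
  power_measure (uniform_prob (@ltr01 R)) n.

End unit_cube.

Arguments unit_cube {R} n _.

Record hypergraph (r : nat) := Hypergraph {
  vertex : finType ;
  edges : {set {set vertex}} ;
  edges_uniform : forall e, e \in edges -> #|e| = r }.

Section density.
Variables (R : realType) (r : nat).

(* Only the values of W on the unit cube are relevant. *)
Record graphon (W : r.-tuple R -> R) : Prop := Graphon {
  graphon_measurable :
    measurable_fun (unit_cube r : set (r.-tuple (measurableTypeR R))) W ;
  graphon_itv : forall x, unit_cube r x -> 0 <= W x <= 1 ;
  graphon_sym : forall x (s : 'S_r), unit_cube r x ->
    W [tuple tnth x (s i) | i < r] = W x }.

Variable H : hypergraph r.

Definition edge_tuple (e : {e : {set vertex H} | e \in edges H}) :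
    r.-tuple (vertex H) :=
  tcast (edges_uniform (valP e)) (enum_tuple (val e)).

(* A point of [0,1]^V(H) is a tuple of #|V(H)| reals; the coordinate of the
   vertex v is the one of index enum_rank v. *)
Definition vertex_coord (x : #|vertex H|.-tuple R) (v : vertex H) : R :=
  tnth x (enum_rank v).

Definition density (W : r.-tuple R -> R) : R :=
  \int[cube_measure R #|vertex H|]_(x in unit_cube #|vertex H|)
    \prod_(e : {e : {set vertex H} | e \in edges H})
      W (map_tuple (vertex_coord x) (edge_tuple e)).

Definition common : Prop :=
  forall W, graphon W ->
    density W + density (fun x => 1 - W x) >= 2 ^ (1 - #|edges H|%:Z).

End density.

Section grid.
Variable r : nat.

Definition hline (j : 'I_r) : {set 'I_r * 'I_r} := [set p | p.2 == j]%SET.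
Definition vline (i : 'I_r) : {set 'I_r * 'I_r} := [set p | p.1 == i]%SET.

Definition grid_edges : {set {set 'I_r * 'I_r}} :=
  ([set hline j | j : 'I_r] :|: [set vline i | i : 'I_r])%SET.

Lemma grid_edges_uniform e : e \in grid_edges -> #|e| = r.
Proof.
rewrite !inE => /orP[] /imsetP[k _ ->].
- rewrite (_ : hline k = finset.setX [set: 'I_r] [set k])%SET.
    by rewrite cardsX cardsT card_ord cards1 muln1.
  by apply/setP => -[a b]; rewrite !inE.
- rewrite (_ : vline k = finset.setX [set k] [set: 'I_r])%SET.
    by rewrite cardsX cardsT card_ord cards1 mul1n.
  by apply/setP => -[a b]; rewrite !inE andbT.
Qed.

Lemma card_grid_edges : (1 < r)%N -> #|grid_edges| = r.*2.
Proof.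
move=> r1; pose o := Ordinal (ltnW r1); pose o1 := Ordinal r1.
have hI : injective hline.
  move=> i j /setP /(_ (o, i)); rewrite !inE /= eqxx => /esym /eqP; exact.
have vI : injective vline.
  move=> i j /setP /(_ (i, o)); rewrite !inE /= eqxx => /esym /eqP; exact.
rewrite cardsU !card_imset// !card_ord addnn.
rewrite (_ : _ :&: _ = finset.set0)%SET ?cards0 ?subn0//.
apply/setP => e; rewrite !inE; apply/negP => /andP[/imsetP[j _ ->]].
move=> /imsetP[i _] /setP hv.
have := hv (o, j); have := hv (o1, j).
by rewrite !inE /= eqxx => /esym /eqP <- /esym /eqP.
Qed.

Definition grid : hypergraph r := Hypergraph grid_edges_uniform.

End grid.

(* Main.v *)
(* Perturb the constant 1/2 by e * u, where u is a step function all of whose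
   one-variable marginals vanish. In the expansion of the density, a proper
   nonempty set of lines of the grid has a vertex of degree one and contributes
   zero, so, the number of lines being even, the density of 1/2 + e * u plus
   that of 1/2 - e * u is 2^(1 - 2r) + 2 e^(2r) t(u), and it suffices that
   t(u) < 0.
   Take u(z) = sum_m c_m D_m(z.1) D_m(z.2), where m ranges over the lines, c_m
   is -1 for one line and 1 for the others, and D_m is the determinant of the
   signed indicators of the points of m. Then
     t(u) = sum_f (prod_l c_(f l)) X_f ^ 2
   over the maps f from lines to lines, X_f being the contraction of the
   alternating tensors D_(f l) along the grid. If f identifies two parallel
   lines, exchanging them in the grid transposes two arguments of r
   determinants, so X_f = - X_f as r is odd. If f identifies a row and a
   column, X_f vanishes for lack of compatible points. Hence only bijective f
   contribute, each with weight -1, and X_id > 0. *)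

Require Import Defs.
From mathcomp Require Import all_boot all_order all_algebra.
From mathcomp Require Import all_fingroup.
From mathcomp Require Import all_classical all_reals all_analysis.
From mathcomp Require Import lra.

Set Implicit Arguments.
Unset Strict Implicit.
Unset Printing Implicit Defensive.

Import Order.TTheory GRing.Theory Num.Theory.
Import numFieldNormedType.Exports.

Local Open Scope classical_set_scope.
Local Open Scope ring_scope.

(** * Lines of the grid and their points *)

Section grid_lines.
Variable r : nat.

(** A sum type rather than a set of point sets, so that products over the lines split into rows
    [inl i] (first coordinate [i]) and columns [inr j] (second coordinate [j]). *)
Definition grid_line : finType := ('I_r + 'I_r)%type.

Definition line_point (l : grid_line) (k : 'I_r) : 'I_r * 'I_r :=
  match l with inl i => (i, k) | inr j => (k, j) end.

Definition on_line (l : grid_line) (v : 'I_r * 'I_r) : bool :=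
  match l with inl i => v.1 == i | inr j => v.2 == j end.

Lemma line_pointP (l : grid_line) (v : 'I_r * 'I_r) :
  reflect (exists k, v = line_point l k) (on_line l v).
Proof.
apply: (iffP idP); case: l v => [i|j] [a b] /=.
- by move/eqP=> ->; exists b.
- by move/eqP=> ->; exists a.
- by case=> k [-> _].
- by case=> k [_ ->].
Qed.

Definition line_swap (l : grid_line) : grid_line :=
  match l with inl i => inr i | inr j => inl j end.

Lemma line_swapK : involutive line_swap.
Proof. by case. Qed.

End grid_lines.

(** * Alternating tensors of lines and their contractions along the grid *)

Section signed_points.
Variables (F : realFieldType) (r : nat).
Local Notation line := (grid_line r).

(** The sign bit makes marginals vanish: a function that is odd in the sign sums to zero. *)
Definition signed_point : finType := ('I_r * 'I_r * bool)%type.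

Definition flip_sign (c : bool) (z : signed_point) : signed_point :=
  (z.1, c (+) z.2).

Lemma flip_signK c : involutive (flip_sign c).
Proof. by case=> v b; rewrite /flip_sign /= addKb. Qed.

Definition point_value (v : 'I_r * 'I_r) (z : signed_point) : F :=
  (-1) ^+ z.2 *+ (z.1 == v).

(** The tensor [D_m]. It vanishes unless the arguments occupy the points of [m] in some order, and
    is then the sign of that order times the product of the sign bits. *)
Definition line_det (m : line) (z : 'I_r -> signed_point) : F :=
  \det (\matrix_(a < r, b < r) point_value (line_point m b) (z a)).

Lemma eq_line_det m z z' : z =1 z' -> line_det m z = line_det m z'.
Proof.
by move=> ezz'; congr (\det _); apply/matrixP=> a b; rewrite !mxE ezz'.
Qed.

Lemma line_det_perm m z (s : 'S_r) :
  line_det m (fun k => z (s k)) = (-1) ^+ s * line_det m z.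
Proof.
rewrite -det_perm -det_mulmx -row_permE; congr (\det _).
by apply/matrixP=> a b; rewrite !mxE.
Qed.

Lemma line_det_flip m z (c : 'I_r -> bool) :
  line_det m (fun k => flip_sign (c k) (z k)) =
  (\prod_k (-1) ^+ c k) * line_det m z.
Proof.
pose D : 'rV[F]_r := \row_k (-1) ^+ c k.
transitivity (\det (diag_mx D) * line_det m z); last first.
  by rewrite det_diag; congr (_ * _); apply: eq_bigr => k _; rewrite mxE.
rewrite -det_mulmx mul_diag_mx; congr (\det _); apply/matrixP=> a b.
by rewrite !mxE /point_value /= signr_addb mulrnAr.
Qed.

(** If [z k] is off [m], row [k] of the matrix is zero. *)
Lemma line_det_on m z k : line_det m z != 0 -> on_line m (z k).1.
Proof.
apply: contraNT => off; rewrite /line_det (expand_det_row _ k) big1// => b _.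
rewrite mxE /point_value; case: eqP => [e|]; last by rewrite mulr0n mul0r.
by move: off; rewrite e => /line_pointP[]; exists b.
Qed.

Lemma line_det_id m z : (forall k, (z k).1 = line_point m k) ->
  line_det m z = \prod_k (-1) ^+ (z k).2.
Proof.
move=> zE; pose D : 'rV[F]_r := \row_k (-1) ^+ (z k).2.
transitivity (\det (diag_mx D)); last first.
  by rewrite det_diag; apply: eq_bigr => k _; rewrite mxE.
congr (\det _); apply/matrixP=> a b; rewrite !mxE /point_value zE.
suff -> : (line_point m a == line_point m b) = (a == b) by [].
by case: m {zE} => i /=; rewrite xpair_eqE eqxx ?andbT.
Qed.

(** The number [X_f]: the signed point summed over at a vertex is an argument of exactly two
    tensors, that of its row and that of its column. *)
Definition line_contraction (f : {ffun line -> line}) : F :=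
  \sum_(p : {ffun 'I_r * 'I_r -> signed_point})
    \prod_l line_det (f l) (fun k => p (line_point l k)).

Lemma sum_ffun_precomp (T S : finType) (g g' : T -> T)
    (G : {ffun T -> S} -> F) : cancel g g' -> cancel g' g ->
  \sum_p G p = \sum_(p : {ffun T -> S}) G [ffun v => p (g v)].
Proof.
move=> gK g'K; rewrite (reindex (fun p : {ffun T -> S} => [ffun v => p (g v)]))//=.
exists (fun p : {ffun T -> S} => [ffun v => p (g' v)]) => p _.
  by apply/ffunP=> v; rewrite !ffunE g'K.
by apply/ffunP=> v; rewrite !ffunE gK.
Qed.

(** Transposing the grid exchanges rows and columns, which reduces the column case below to the row
    case. *)
Lemma line_contraction_swap (f : {ffun line -> line}) :
  line_contraction [ffun l => f (line_swap l)] = line_contraction f.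
Proof.
pose g (v : 'I_r * 'I_r) := (v.2, v.1).
have gK : involutive g by case.
rewrite /line_contraction [RHS](sum_ffun_precomp _ gK gK).
apply: eq_bigr => p _; rewrite (reindex_inj (inv_inj (@line_swapK r)))/=.
apply: eq_bigr => l _; rewrite ffunE line_swapK; apply: eq_line_det => k.
by rewrite ffunE; case: l.
Qed.

Lemma prod_lines (f : line -> F) :
  \prod_l f l = \prod_(i < r) f (inl i) * \prod_(j < r) f (inr j).
Proof. by rewrite big_sumType. Qed.

(* Swapping two rows with the same image changes the sign of each of the r
   column determinants and permutes the row determinants. *)
Lemma line_contraction_row (f : {ffun line -> line}) (i i' : 'I_r) :
  odd r -> i != i' -> f (inl i) = f (inl i') -> line_contraction f = 0.
Proof.
move=> r_odd ii' fii'; apply/eqP; rewrite -eqNr eq_sym; apply/eqP.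
pose s := tperm i i'.
pose g (v : 'I_r * 'I_r) := (s v.1, v.2).
have gK : involutive g by case=> a b; rewrite /g /= /s tpermK.
rewrite {2}/line_contraction (sum_ffun_precomp _ gK gK) -sumrN.
apply: eq_bigr => p _; rewrite !prod_lines.
have -> : \prod_(k < r) line_det (f (inl k))
    (fun k0 => [ffun v => p (g v)] (line_point (inl k) k0)) =
  \prod_(k < r) line_det (f (inl k)) (fun k0 => p (line_point (inl k) k0)).
  rewrite [RHS](reindex_inj (@perm_inj _ s))/=; apply: eq_bigr => k _.
  have -> : f (inl (s k)) = f (inl k).
    by rewrite /s; case: tpermP => [->|->|].
  by apply: eq_line_det => k0; rewrite ffunE.
rewrite -mulrN; congr (_ * _).
have colN (j : 'I_r) : line_det (f (inr j))
      (fun k => [ffun v => p (g v)] (line_point (inr j) k)) =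
    - line_det (f (inr j)) (fun k => p (line_point (inr j) k)).
  transitivity ((-1) ^+ s *
      line_det (f (inr j)) (fun k => p (line_point (inr j) k))).
    rewrite -(line_det_perm _ (fun k => p (line_point (inr j) k))).
    by apply: eq_line_det => k; rewrite ffunE.
  by rewrite odd_tperm ii' expr1 mulN1r.
rewrite (eq_bigr _ (fun j _ => colN j)) prodrN cardT size_enum_ord.
by rewrite -signr_odd r_odd expr1 mulN1r opprK.
Qed.

Lemma line_contraction_col (f : {ffun line -> line}) (j j' : 'I_r) :
  odd r -> j != j' -> f (inr j) = f (inr j') -> line_contraction f = 0.
Proof.
move=> r_odd jj' fjj'; rewrite -line_contraction_swap.
by apply: (line_contraction_row r_odd jj'); rewrite !ffunE.
Qed.

Definition is_row (l : line) : bool := if l is inl _ then true else false.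

Lemma parallel_lines_meet (l m : line) v :
  is_row l = is_row m -> on_line l v -> on_line m v -> l = m.
Proof.
by case: l m => [i|j] [i'|j'] //= _ /eqP <- /eqP <-.
Qed.

Lemma exists_neq2 (i : 'I_r) : (3 <= r)%N -> exists k k' : 'I_r,
  [/\ k != i, k' != i & k != k'].
Proof.
move=> r3; have : (1 < #|[set~ i]%SET|)%N.
  by rewrite cardsC1 card_ord; case: (r) r3 => [|[|[]]].
by case/card_gt1P => k [k' []]; rewrite !inE => ki k'i kk'; exists k, k'.
Qed.

(** In a nonzero term, [p] sends the common vertex of a row and a column to a common point of their
    images. Incidence alone then contradicts injectivity on rows. *)
Lemma line_contraction_cross (f : {ffun line -> line}) (i j : 'I_r) :
  (3 <= r)%N -> injective (fun k => f (inl k)) -> injective (fun k => f (inr k)) ->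
  f (inl i) = f (inr j) -> line_contraction f = 0.
Proof.
move=> r3 injl injr fij; apply: big1 => p _; apply/eqP/negPn/negP => nz.
have on l k : on_line (f l) (p (line_point l k)).1.
  apply: (@line_det_on (f l) (fun k => p (line_point l k))).
  by move/prodf_neq0: nz; apply.
(* Row [k] meets column [j], whose image is that of row [i]. Parallel images would share a point and
   coincide. *)
have rowN k : k != i -> is_row (f (inl k)) != is_row (f (inl i)).
  apply: contraNneq => e.
  rewrite -(inj_eq injl); apply/eqP/(parallel_lines_meet e (on (inl k) j)).
  by rewrite fij; exact: (on (inr j) k).
have colN k : k != j -> is_row (f (inr k)) != is_row (f (inl i)).
  rewrite fij; apply: contraNneq => e.
  rewrite -(inj_eq injr); apply/eqP/(parallel_lines_meet e (on (inr k) i)).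
  by rewrite -fij; exact: (on (inl i) k).
(* Both images have the direction opposite to [f (inl i)], so they are parallel and share
   [p (k, l)]. *)
have eqN k l : k != i -> l != j -> f (inl k) = f (inr l).
  move=> /rowN ki /colN lj; apply: parallel_lines_meet (on (inl k) l) (on (inr l) k).
  by move: ki lj; do 3 case: is_row.
(* As [r >= 3], two rows other than [i] exist; both have the image of column [l]. *)
have [k [k' [ki k'i /eqP]]] := exists_neq2 i r3; apply.
have [l [_ [lj _ _]]] := exists_neq2 j r3.
by apply: injl => /=; rewrite !(eqN _ l).
Qed.

Lemma line_contraction_inj (f : {ffun line -> line}) :
  (3 <= r)%N -> odd r -> line_contraction f != 0 -> injective f.
Proof.
move=> r3 r_odd nz.
have injl : injective (fun k => f (inl k)).
  move=> i i' e; apply/eqP; apply: contraNT nz => ii'.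
  by apply/eqP/(line_contraction_row r_odd ii' e).
have injr : injective (fun k => f (inr k)).
  move=> i i' e; apply/eqP; apply: contraNT nz => ii'.
  by apply/eqP/(line_contraction_col r_odd ii' e).
move=> [i|i] [j|j] e.
- by rewrite (injl _ _ e).
- by move: nz; rewrite (line_contraction_cross r3 injl injr e) eqxx.
- by move: nz; rewrite (line_contraction_cross r3 injl injr (esym e)) eqxx.
- by rewrite (injr _ _ e).
Qed.

(** The square comes from each vertex lying on one row and one column. *)
Lemma prod_grid_lines (g : 'I_r * 'I_r -> F) :
  \prod_(l : line) \prod_k g (line_point l k) = \prod_v g v ^+ 2.
Proof.
rewrite prod_lines /=; under [X in _ = X]eq_bigr do rewrite expr2.
rewrite big_split /=; congr (_ * _); last rewrite exchange_big/=;
  by rewrite pair_bigA /=; apply: eq_bigr => -[].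
Qed.

(** If [p] fixes the position of every vertex, each sign occurs twice and the term is 1; otherwise
    the term is 0. *)
Lemma line_contraction_id : 0 < line_contraction [ffun l => l].
Proof.
pose q : {ffun 'I_r * 'I_r -> signed_point} := [ffun v => (v, false)].
have q1 : (forall v, (q v).1 = v) by move=> v; rewrite ffunE.
have pos (p : {ffun 'I_r * 'I_r -> signed_point}) : (forall v, (p v).1 = v) ->
    \prod_l line_det ([ffun l => l] l) (fun k => p (line_point l k)) = 1.
  move=> p1; under eq_bigr => l _ do rewrite ffunE (@line_det_id l)//.
  rewrite (prod_grid_lines (fun v => (-1) ^+ (p v).2)) big1// => v _.
  by rewrite sqrr_sign.
rewrite /line_contraction (bigD1 q)//= pos// ltr_wpDr// sumr_ge0// => p _.
have [/forallP p1|] := boolP [forall v, (p v).1 == v].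
  by rewrite pos// => v; exact/eqP.
rewrite negb_forall => /existsP[[i j] pij].
(* A displaced vertex leaves its row or its column, and the determinant of that line vanishes. *)
suff [l [k [E off]]] : exists (l : line) k,
    line_point l k = (i, j) /\ ~~ on_line l (p (i, j)).1.
  rewrite (bigD1 l)//= ffunE.
  have -> : line_det l (fun k => p (line_point l k)) = 0; last by rewrite mul0r.
  by apply/eqP; apply: contraNT off => /(line_det_on k); rewrite E.
move: pij; case: (p (i, j)) => -[a b] c /=; rewrite xpair_eqE negb_and.
by case/orP => ne; [exists (inl i), j | exists (inr j), i].
Qed.

End signed_points.

(** * The kernel [u] and the sign of its density *)

Section kernel.
Variables (F : realFieldType) (r : nat) (l0 : grid_line r).
Local Notation line := (grid_line r).

(** One signed point for each of the two factors [D_m]. Doubling cancels the signs of permutations,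
    making the kernel symmetric, and turns each [X_f] into a square. *)
Definition kernel_state : finType := (signed_point r * signed_point r)%type.

Definition grid_kernel (z : 'I_r -> kernel_state) : F :=
  \sum_m (-1) ^+ (m == l0) *
    (line_det F m (fun k => (z k).1) * line_det F m (fun k => (z k).2)).

Lemma eq_grid_kernel z z' : z =1 z' -> grid_kernel z = grid_kernel z'.
Proof.
by move=> e; apply: eq_bigr => m _; congr (_ * (_ * _));
  apply: eq_line_det => k; rewrite e.
Qed.

Lemma grid_kernel_perm z (s : 'S_r) :
  grid_kernel (fun k => z (s k)) = grid_kernel z.
Proof.
apply: eq_bigr => m _; rewrite (line_det_perm F _ (fun k => (z k).1)).
by rewrite (line_det_perm F _ (fun k => (z k).2)) mulrACA -signr_addb addbb mul1r.
Qed.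

(* Flipping both components would leave the kernel unchanged. *)
Definition flip_state (c : bool) (z : kernel_state) : kernel_state :=
  (flip_sign c z.1, z.2).

Lemma flip_stateK c : involutive (flip_state c).
Proof. by case=> z1 z2; rewrite /flip_state flip_signK. Qed.

Lemma grid_kernel_flip z (c : 'I_r -> bool) :
  grid_kernel (fun k => flip_state (c k) (z k)) =
  (\prod_k (-1) ^+ c k) * grid_kernel z.
Proof.
rewrite /grid_kernel mulr_sumr; apply: eq_bigr => m _ /=.
rewrite (line_det_flip F _ (fun k => (z k).1)).
by rewrite -!mulrA mulrCA.
Qed.

(** The grid density of a step function, before division by the number of assignments [p]. *)
Definition state_density (w : ('I_r -> kernel_state) -> F) : F :=
  \sum_(p : {ffun 'I_r * 'I_r -> kernel_state})
    \prod_(l : line) w (fun k => p (line_point l k)).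

Lemma prod_sign_on_line (l : line) v :
  \prod_k (-1) ^+ (line_point l k == v) = (-1) ^+ on_line l v :> F.
Proof.
case: l v => [i|j] [a b] /=.
  rewrite (bigD1 b)//= big1 ?mulr1 => [|k kb]; rewrite xpair_eqE.
    by rewrite eqxx andbT eq_sym.
  by rewrite (negPf kb) andbF.
rewrite (bigD1 a)//= big1 ?mulr1 => [|k kb]; rewrite xpair_eqE.
  by rewrite eqxx eq_sym.
by rewrite (negPf kb).
Qed.

(* A proper nonempty set of lines covers some vertex exactly once; flipping
   the sign at that vertex negates the sum. *)
Lemma kernel_proper_subset (A : {set line}) : A != finset.set0 -> A != finset.setT ->
  \sum_(p : {ffun 'I_r * 'I_r -> kernel_state})
    \prod_(l in A) grid_kernel (fun k => p (line_point l k)) = 0.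
Proof.
case/finset.set0Pn => l lA AT.
(* Every row meets every column, so if membership agreed at all vertices, the line [l] in [A] would
   force all lines into [A]. *)
have [v vA] : exists v : 'I_r * 'I_r, (inl v.1 \in A) != (inr v.2 \in A).
  apply/existsP; apply: contraNT AT; rewrite negb_exists => /forallP eA.
  have {}eA (i j : 'I_r) : (inl i \in A) = (inr j \in A).
    by have := eA (i, j); rewrite negbK => /eqP.
  apply/eqP/setP => l'; rewrite inE.
  case: l l' lA => [i|j] [i'|j'] lA.
  - by rewrite (eA _ i) -(eA i).
  - by rewrite -(eA i).
  - by rewrite (eA _ j).
  - by rewrite -(eA j) (eA _ j).
pose h (p : {ffun 'I_r * 'I_r -> kernel_state}) :=
  [ffun w => flip_state (w == v) (p w)].
have hK : involutive h.
  by move=> p; apply/ffunP=> w; rewrite !ffunE flip_stateK.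
apply/eqP; rewrite -eqNr eq_sym; apply/eqP.
rewrite {2}(reindex_inj (inv_inj hK))/= -sumrN; apply: eq_bigr => p _.
have -> : \prod_(l in A) grid_kernel (fun k => h p (line_point l k)) =
    \prod_(l in A) ((-1) ^+ on_line l v * grid_kernel (fun k => p (line_point l k))).
  apply: eq_bigr => l' _; rewrite -prod_sign_on_line -grid_kernel_flip.
  by apply: eq_grid_kernel => k; rewrite ffunE.
rewrite big_split /=.
suff -> : \prod_(l in A) (-1) ^+ on_line l v = -1 :> F by rewrite mulN1r opprK.
(* Only row [v.1] and column [v.2] pass through [v], and exactly one of them is in [A]. *)
rewrite big_mkcond prod_lines /= (bigD1 v.1)//= [X in _ * X](bigD1 v.2)//=.
rewrite !big1 ?mulr1 ?eqxx.
- by move: vA; do 2 case: (_ \in A); rewrite ?mul1r ?mulr1.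
- by move=> j; rewrite eq_sym => /negPf ->; rewrite if_same.
- by move=> j; rewrite eq_sym => /negPf ->; rewrite if_same.
Qed.

(** Expand over the set [J] of lines at which the kernel is chosen: only the empty and the full [J]
    survive. *)
Lemma state_density_affine (c e : F) :
  state_density (fun z => c + e * grid_kernel z) =
  c ^+ r.*2 *+ #|{ffun 'I_r * 'I_r -> kernel_state}|
    + e ^+ r.*2 * state_density grid_kernel.
Proof.
have cardL : #|line| = r.*2 by rewrite card_sum !card_ord addnn.
rewrite {1}/state_density; under eq_bigr => p _.
  rewrite (eq_bigr (fun l => e * grid_kernel (fun k => p (line_point l k)) + c)).
    rewrite bigA_distr; over.
  by move=> l _; rewrite addrC.
rewrite exchange_big /=.
have -> : \sum_(J in {set line}) \sum_(p : {ffun 'I_r * 'I_r -> kernel_state})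
     \prod_l (if l \in J then e * grid_kernel (fun k => p (line_point l k)) else c)
  = \sum_(J in {set line}) (e ^+ #|J| * c ^+ #|~: J|%SET *
      \sum_(p : {ffun 'I_r * 'I_r -> kernel_state})
        \prod_(l in J) grid_kernel (fun k => p (line_point l k))).
  apply: eq_bigr => J _; rewrite mulr_sumr; apply: eq_bigr => p _.
  rewrite (bigID (mem J))/= (eq_bigr (fun l =>
    e * grid_kernel (fun k => p (line_point l k)))); last by move=> l ->.
  rewrite big_split/= prodr_const mulrAC; congr (_ * _ * _).
  rewrite (eq_bigr (fun=> c)); last by move=> l /negPf ->.
  by rewrite prodr_const; congr (_ ^+ _); apply: eq_card => l; rewrite inE.
(* The empty and full sets differ because the index in [l0] forces [r > 0]. *)
rewrite (bigD1 finset.set0)//= (bigD1 finset.setT)/=; last first.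
  rewrite -card_gt0 cardsT cardL double_gt0.
  by case: l0 => -[k kr]; apply: leq_ltn_trans kr.
rewrite [X in _ + (_ + X)]big1 ?addr0; last first.
  by move=> J /andP[J0 JT]; rewrite kernel_proper_subset// mulr0.
rewrite cards0 finset.setC0 finset.setCT cards0 cardsT cardL !expr0 mul1r mulr1.
congr (_ + _).
  under eq_bigr do rewrite finset.big_set0.
  by rewrite sumr_const mulrnAr mulr1.
by congr (_ * _); apply: eq_bigr => p _; apply: eq_bigl => l; rewrite inE.
Qed.

(** Distributing the product over the sum in the kernel chooses a line [f l] for each [l]; the two
    components of the states then sum independently. *)
Lemma state_density_kernel : state_density grid_kernel =
  \sum_(f : {ffun line -> line})
    (\prod_l (-1) ^+ (f l == l0)) * line_contraction F f ^+ 2.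
Proof.
rewrite /state_density; under eq_bigr do rewrite bigA_distr_bigA.
rewrite exchange_big /=; apply: eq_bigr => f _.
under eq_bigr do rewrite big_split/=.
rewrite -mulr_sumr; congr (_ * _); rewrite expr2 /line_contraction.
rewrite mulr_suml; under [RHS]eq_bigr do rewrite mulr_sumr.
rewrite pair_bigA/=.
rewrite (reindex (fun pq : {ffun 'I_r * 'I_r -> signed_point r} *
  {ffun 'I_r * 'I_r -> signed_point r} => [ffun v => (pq.1 v, pq.2 v)]))/=.
  apply: eq_bigr => -[p q] _ /=; rewrite -big_split /=.
  apply: eq_bigr => l _.
  by congr (_ * _); apply: eq_line_det => k; rewrite ffunE.
exists (fun p => ([ffun v => (p v).1], [ffun v => (p v).2])) => [[p q]|p] _.
  by congr (_, _); apply/ffunP=> v; rewrite !ffunE.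
by apply/ffunP=> v; rewrite !ffunE -surjective_pairing.
Qed.

Lemma state_density_kernel_lt0 : (3 <= r)%N -> odd r ->
  state_density grid_kernel < 0.
Proof.
move=> r3 r_odd; rewrite state_density_kernel.
(* An injective self-map of the lines takes the value [l0] exactly once. *)
have sgn (f : {ffun line -> line}) : injective f ->
    \prod_l (-1) ^+ (f l == l0) = -1 :> F.
  move=> injf; transitivity (\prod_l (-1) ^+ (l == l0) : F).
    by rewrite [RHS](reindex_inj injf).
  by rewrite (bigD1 l0)//= eqxx big1 ?mulr1// => l /negPf ->.
rewrite (bigD1 [ffun l => l])//= sgn; last by move=> l l'; rewrite !ffunE.
rewrite mulN1r ltr_wnDr ?oppr_lt0 ?exprn_gt0 ?line_contraction_id//.
apply: sumr_le0 => f _.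
have [->|nz] := eqVneq (line_contraction F f) 0; first by rewrite expr0n mulr0.
by rewrite sgn ?mulN1r ?oppr_le0 ?sqr_ge0//; exact: line_contraction_inj nz.
Qed.

End kernel.

(** * Step functions on the unit cube *)

Section step_functions.
Variables (R : realType) (S : finType) (S_gt0 : (0 < #|S|)%N).

Local Notation unif := (uniform_prob (@ltr01 R)).

(** Cut the unit interval into [#|S|] consecutive intervals of equal length, labelled by [S]. *)
Lemma equipartition_exists : exists phi : R -> S, forall s,
  measurable (phi @^-1` [set s] `&` `[0, 1] : set (measurableTypeR R)) /\
  unif (phi @^-1` [set s] `&` `[0, 1]) = (#|S|%:R^-1)%:E.
Proof.
have [n Sn] : exists n, #|S| = n.+1 by exists #|S|.-1; rewrite prednK.
pose N : R := n.+1%:R; have N0 : 0 < N by rewrite ltr0n.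
(* The last part is closed on the right because of the minimum. *)
pose idx (x : R) : 'I_n.+1 := inord (minn n (Num.truncn (N * x))).
pose phi x : S := enum_val (cast_ord (esym Sn) (idx x)).
exists phi => s.
have [k idxE] : exists k : 'I_n.+1,
    forall x, (phi x = s) <-> minn n (Num.truncn (N * x)) = k.
  exists (cast_ord Sn (enum_rank s)) => x.
  have idx_val : idx x = minn n (Num.truncn (N * x)) :> nat.
    by rewrite inordK// ltnS geq_minl.
  split=> [e|e]; first by rewrite -e /phi enum_valK /= idx_val.
  rewrite /phi -[RHS]enum_rankK; congr enum_val; apply: val_inj.
  by rewrite /= idx_val e.
(* As an upper bound, [BSide true] excludes the endpoint and [BSide false] includes it, so only the
   part [k = n] is closed. *)
pose J : interval R := Interval (BLeft (k%:R / N)) (BSide (k < n)%N (k.+1%:R / N)).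
have -> : phi @^-1` [set s] `&` `[0, 1] = [set` J].
  apply/seteqP; split=> x /=; rewrite !in_itv /=.
    case=> /idxE e /andP[x0 x1].
    have Nx0 : 0 <= N * x by rewrite mulr_ge0// ltW.
    rewrite ler_pdivrMr// [x * _]mulrC lteif_pdivlMr// [x * _]mulrC.
    have /andP[lo hi] := truncn_itv Nx0.
    have [kn|] := ltnP k n.
      move: e kn; rewrite /minn; case: ltnP => [_ <-|_ <-].
        by rewrite ltnn.
      by move=> _; rewrite /= lo hi.
    move=> nk; have kE : k = n :> nat.
      by apply/eqP; rewrite eqn_leq nk -ltnS ltn_ord.
    rewrite -[k.+1]/(k.+1)%N kE /= -/N; apply/andP; split.
      apply: le_trans lo; rewrite ler_nat.
      by move: e; rewrite kE => /minn_idPl.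
    by rewrite -[leRHS]mulr1 ler_pM2l.
  rewrite ler_pdivrMr// [x * _]mulrC lteif_pdivlMr// [x * _]mulrC.
  case/andP=> lo hi.
  have Nx0 : 0 <= N * x by apply: le_trans lo; rewrite ler0n.
  have x0 : 0 <= x by rewrite -(pmulr_rge0 _ N0).
  split.
    apply/idxE; have [kn|nk] := ltnP k n; rewrite ?kn in hi.
      rewrite (_ : Num.truncn _ = k); last by apply: truncn_def; rewrite lo.
      by apply/minn_idPr/ltnW.
    have kE : k = n :> nat by apply/eqP; rewrite eqn_leq nk -ltnS ltn_ord.
    by rewrite kE; apply/minn_idPl; rewrite truncn_ge_nat// -kE.
  rewrite x0 /= -(ler_pM2l N0) mulr1; apply: le_trans (lteifW hi) _.
  by rewrite ler_nat.
have mJ : measurable ([set` J] : set (measurableTypeR R)).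
  exact: measurable_itv.
split=> //.
have J01 : [set` J] `<=` `[0, 1].
  move=> x; rewrite /= !in_itv /= => /andP[lo /lteifW hi].
  apply/andP; split; first by apply: le_trans lo; rewrite divr_ge0.
  by apply: le_trans hi _; rewrite ler_pdivrMr// mul1r ler_nat.
rewrite /uniform_prob (eq_integral (fun=> 1%:E)); last first.
  move=> x; rewrite inE => /J01; rewrite /= in_itv /= /uniform_pdf => ->.
  by rewrite subr0 invr1.
rewrite integral_cst// mul1e.
rewrite [LHS](lebesgue_measure_itv J) /= lte_fin ltr_pM2r ?invr_gt0//.
rewrite ltr_nat ltnSn -EFinD -mulrBl -[k.+1]addn1 natrD addrAC subrr add0r mul1r.
by rewrite Sn.
Qed.

Variables (phi : R -> S).
Hypothesis phi_measurable : forall s,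
  measurable (phi @^-1` [set s] `&` `[0, 1] : set (measurableTypeR R)).
Hypothesis phi_unif : forall s,
  unif (phi @^-1` [set s] `&` `[0, 1]) = (#|S|%:R^-1)%:E.

Definition cell n (t : {ffun 'I_n -> S}) : set (n.-tuple (measurableTypeR R)) :=
  [set x | forall i, (phi @^-1` [set t i] `&` `[0, 1]) (tnth x i)].

Lemma measurable_box n (A : 'I_n -> set (measurableTypeR R)) :
  (forall i, measurable (A i)) ->
  measurable [set x : n.-tuple (measurableTypeR R) | forall i, A i (tnth x i)].
Proof.
move=> mA; rewrite (_ : mkset _ = \bigcap_(i in [set: 'I_n]) [set x | A i (tnth x i)]).
  apply: fin_bigcap_measurable => [|i _]; first exact: finite_finset.
  have := @measurable_tnth _ (measurableTypeR R) n i measurableT _ (mA i).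
  by rewrite setTI.
by apply/seteqP; split=> x h i //=; exact: h.
Qed.

Lemma measurable_cell n (t : {ffun 'I_n -> S}) : measurable (cell t).
Proof. exact: (measurable_box (fun i => phi_measurable (t i))). Qed.

Lemma measurable_unit_cube n :
  measurable (unit_cube n : set (n.-tuple (measurableTypeR R))).
Proof.
rewrite (_ : unit_cube n = [set x | forall i, `[0, 1]%classic (tnth x i)]).
  by apply: (measurable_box (A := fun=> `[0, 1]%classic)) => i; exact: measurable_itv.
by apply/seteqP; split=> x h i; have := h i; rewrite /= in_itv.
Qed.

Lemma cell_sub_cube n (t : {ffun 'I_n -> S}) : cell t `<=` unit_cube n.
Proof. by move=> x h i; have [_] := h i; rewrite /= in_itv. Qed.

Lemma cube_measure_cell n (t : {ffun 'I_n -> S}) :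
  cube_measure R n (cell t) = (#|S|%:R^-1 ^+ n)%:E.
Proof.
rewrite /cube_measure /cell (power_measure_box _
  (fun i => phi_measurable (t i))).
under eq_bigr do rewrite [X in X _]/= phi_unif.
by rewrite prodEFin prodr_const card_ord.
Qed.

(** A point of the cube lies in exactly one cell, that of its labels. Measurability and integrals
    thus reduce to indicators of cells. *)
Lemma step_functionE n (G : {ffun 'I_n -> S} -> R) (x : n.-tuple R) :
  unit_cube n x ->
  G [ffun i => phi (tnth x i)] = \sum_t G t * \1_(cell t) x.
Proof.
move=> x01; rewrite (bigD1 [ffun i => phi (tnth x i)])//= big1 ?addr0 => [|t ne].
  rewrite indicE mem_set ?mulr1// => i; split; first by rewrite /= ffunE.
  by rewrite /= in_itv; exact: x01.
rewrite indicE memNset ?mulr0// => cx; case/eqP: ne; apply/ffunP => i.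
by rewrite ffunE; have [<-] := cx i.
Qed.

Lemma measurable_step_function n (G : {ffun 'I_n -> S} -> R) :
  measurable_fun (unit_cube n : set (n.-tuple (measurableTypeR R)))
    (fun x => G [ffun i => phi (tnth x i)]).
Proof.
apply: (eq_measurable_fun (fun x => \sum_t G t * \1_(cell t) x)).
  by move=> x; rewrite inE => /(step_functionE G) ->.
apply: measurable_sum => t; apply: measurable_realfun.measurable_funM => //.
exact: (measurable_realfun.measurable_indic (measurable_cell t)).
Qed.

Lemma integral_step_function n (G : {ffun 'I_n -> S} -> R) :
  \int[cube_measure R n]_(x in unit_cube n) G [ffun i => phi (tnth x i)] =
  #|S|%:R^-1 ^+ n * \sum_t G t.
Proof.
have mD := @measurable_unit_cube n.
rewrite /Rintegral (eq_integral (fun x => \sum_t (G t * \1_(cell t) x)%:E)%E).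
  have intf t : (cube_measure R n).-integrable (unit_cube n)
      (fun x => (G t * \1_(cell t) x)%:E).
    under eq_fun do rewrite EFinM; apply: integrableZl => //.
    by apply: integrableS (integrable_indic _ (measurable_cell t)).
  rewrite integral_sum//.
  have intE t : (\int[cube_measure R n]_(x in unit_cube n)
      (G t * \1_(cell t) x)%:E = (#|S|%:R^-1 ^+ n * G t)%:E)%E.
    under eq_integral do rewrite EFinM.
    rewrite integralZl//; last first.
      by apply: integrableS (integrable_indic _ (measurable_cell t)).
    rewrite integral_indic//; last exact: measurable_cell.
    rewrite setIidl; last exact: cell_sub_cube.
    by rewrite [X in (_ * X)%E](cube_measure_cell t) -EFinM mulrC.
  by under eq_bigr do rewrite intE; rewrite sumEFin /= mulr_sumr.
by move=> x; rewrite inE => /(step_functionE G) ->; rewrite sumEFin.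
Qed.

Lemma density_step r (H : hypergraph r) (w : ('I_r -> S) -> R) :
  density H (fun x => w (fun k => phi (tnth x k))) =
  #|S|%:R^-1 ^+ #|vertex H| * \sum_(p : {ffun vertex H -> S})
    \prod_(e : {e : {set vertex H} | e \in edges H})
      w (fun k => p (tnth (edge_tuple e) k)).
Proof.
pose G (t : {ffun 'I_#|vertex H| -> S}) :=
  \prod_(e : {e : {set vertex H} | e \in edges H})
    w (fun k => t (enum_rank (tnth (edge_tuple e) k))).
rewrite /density.
transitivity (\int[cube_measure R #|vertex H|]_(x in unit_cube #|vertex H|)
    G [ffun i => phi (tnth x i)]).
  apply: eq_Rintegral => x _; apply: eq_bigr => e _; congr w.
  by apply/funext => k; rewrite tnth_map ffunE.
rewrite integral_step_function; congr (_ * _).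
(* Pass from labels of coordinates to labels of vertices. *)
rewrite (reindex (fun p : {ffun vertex H -> S} => [ffun i => p (enum_val i)]))/=.
  apply: eq_bigr => p _; apply: eq_bigr => e _; congr w.
  by apply/funext => k; rewrite ffunE enum_rankK.
exists (fun t : {ffun 'I_#|vertex H| -> S} => [ffun v => t (enum_rank v)]) => p _.
  by apply/ffunP => v; rewrite !ffunE enum_rankK.
by apply/ffunP => i; rewrite !ffunE enum_valK.
Qed.

Lemma graphon_step r (w : ('I_r -> S) -> R) :
  (forall z, 0 <= w z <= 1) -> (forall z (s : 'S_r), w (fun k => z (s k)) = w z) ->
  graphon (fun x : r.-tuple R => w (fun k => phi (tnth x k))).
Proof.
move=> w01 wS; split=> [|x _|x s _].
- pose G (t : {ffun 'I_r -> S}) := w t.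
  apply: (eq_measurable_fun (fun x => G [ffun i => phi (tnth x i)])).
    by move=> x _; congr w; apply/funext => k; rewrite ffunE.
  exact: measurable_step_function.
- exact: w01.
- rewrite -[RHS](wS _ s); congr w; apply/funext => k.
  by rewrite tnth_mktuple.
Qed.

End step_functions.

(** * Edges of the grid hypergraph as lines *)

Section grid_density.
Variable r : nat.
Hypothesis r_ge3 : (3 <= r)%N.
Local Notation line := (grid_line r).

Definition line_set (l : line) : {set 'I_r * 'I_r} :=
  match l with inl i => Defs.vline i | inr j => hline j end.

Lemma in_line_set l v : (v \in line_set l) = on_line l v.
Proof. by case: l => i; rewrite inE. Qed.

Lemma line_set_edge l : line_set l \in grid_edges r.
Proof.
by case: l => i; rewrite inE; apply/orP; [right|left]; apply/imsetP; exists i.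
Qed.

Lemma line_set_inj : injective line_set.
Proof.
move=> l l' e.
have eL v : on_line l v = on_line l' v by rewrite -!in_line_set e.
case: l l' {e} eL => [i|j] [i'|j'] eL.
- by have := eL (i, i); rewrite /= eqxx => /esym /eqP ->.
- have [k [_ [kj _ _]]] := exists_neq2 j' r_ge3.
  by have := eL (i, k); rewrite /= eqxx (negPf kj).
- have [k [_ [ki _ _]]] := exists_neq2 i' r_ge3.
  by have := eL (k, j); rewrite /= eqxx (negPf ki).
- by have := eL (j, j); rewrite /= eqxx => /esym /eqP ->.
Qed.

Definition line_edge (l : line) : {e : {set vertex (grid r)} | e \in edges (grid r)} :=
  exist _ (line_set l) (line_set_edge l).

Lemma line_edge_bij : bijective line_edge.
Proof.
apply: inj_card_bij => [l l' /(congr1 val) /line_set_inj //|].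
rewrite card_sig (eq_card (B := grid_edges r))//.
by rewrite card_grid_edges ?(ltnW r_ge3)// card_sum !card_ord addnn.
Qed.

(** [edge_tuple] follows the enumeration of the vertices, so it matches [line_point] only up to a
    permutation, which a symmetric [w] absorbs. *)
Lemma line_edge_tuple (l : line) : exists s : 'S_r,
  forall k, tnth (edge_tuple (line_edge l)) k = line_point l (s k).
Proof.
have line_point_inj : injective (line_point l).
  by case: l => i k k' [].
have : perm_eq (edge_tuple (line_edge l)) (mktuple (line_point l)).
  apply: uniq_perm.
  - by rewrite val_tcast enum_uniq.
  - by rewrite map_inj_uniq ?enum_uniq.
  - move=> v; rewrite val_tcast mem_enum /= in_line_set.
    apply/line_pointP/mapP => [[k ->]|[k _ ->]]; exists k => //.
    by rewrite mem_enum.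
case/tuple_permP => s es; exists s => k.
have -> : edge_tuple (line_edge l) =
    [tuple tnth (mktuple (line_point l)) (s i) | i < r] by exact: val_inj.
by rewrite !tnth_mktuple.
Qed.

Lemma prod_grid_edges (F : realFieldType) (S : Type) (w : ('I_r -> S) -> F)
    (p : 'I_r * 'I_r -> S) :
  (forall z (s : 'S_r), w (fun k => z (s k)) = w z) ->
  \prod_(e : {e : {set vertex (grid r)} | e \in edges (grid r)})
    w (fun k => p (tnth (edge_tuple e) k)) =
  \prod_l w (fun k => p (line_point l k)).
Proof.
move=> wS; rewrite (reindex line_edge)/=; last exact/onW_bij/line_edge_bij.
apply: eq_bigr => l _; have [s es] := line_edge_tuple l.
rewrite -(wS (fun k => p (line_point l k)) s); congr w.
by apply/funext => k; rewrite es.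
Qed.

End grid_density.

(** * Scaling of the perturbation and failure of commonness *)

Lemma exists_scale_le_half (F : realFieldType) (T S : finType)
  (u : (T -> S) -> F) : exists2 e : F, 0 < e & forall z, `|e * u z| <= 2^-1.
Proof.
(* The sum bounds every value of [u]; the 1 keeps [M] positive even if [u] is zero. *)
pose M : F := 1 + \sum_(z : {ffun T -> S}) `|u z|.
have M0 : 0 < M by rewrite ltr_pwDl ?sumr_ge0.
exists (2 * M)^-1 => [|z]; first by rewrite invr_gt0 mulr_gt0.
rewrite normrM gtr0_norm ?invr_gt0 ?mulr_gt0// invfM -mulrA.
rewrite ler_piMr ?invr_ge0// ler_pdivrMl// mulr1 /M.
have -> : u z = u [ffun t => z t] by congr u; apply/funext => t; rewrite ffunE.
by rewrite (bigD1 [ffun t => z t])//= addrCA lerDl addr_ge0 ?sumr_ge0.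
Qed.

Theorem theorem1p6 (R : realType) (r : nat) (r_ge3 : (3 <= r)%N)
  (r_odd : odd r) : ~ common R (grid r).
Proof.
pose l0 : grid_line r := inl (Ordinal (ltnW (ltnW r_ge3))).
pose u := @grid_kernel R r l0.
pose S := kernel_state r.
have S_gt0 : (0 < #|S|)%N.
  by apply/card_gt0P; pose i := Ordinal (ltnW (ltnW r_ge3));
    exists (((i, i), true), ((i, i), true)).
have [phi phiP] := equipartition_exists R S_gt0.
have phi_measurable s := (phiP s).1; have phi_unif s := (phiP s).2.
have [e e_gt0 ue] := exists_scale_le_half u.
pose w (c : R) (z : 'I_r -> S) := 2^-1 + c * u z.
have wS c z (s : 'S_r) : w c (fun k => z (s k)) = w c z.
  by rewrite /w /u grid_kernel_perm.
pose W (x : r.-tuple R) := w e (fun k => phi (tnth x k)).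
move=> /(_ W); apply/not_implyP; split.
  apply: (graphon_step phi_measurable) => // z.
  by have := ue z; rewrite ler_norml /w; lra.
(* Complementing 1/2 + e u only changes the sign of [e], so one computation serves both
   densities. *)
have WN : (fun x => 1 - W x) = fun x => w (- e) (fun k => phi (tnth x k)).
  by apply/funext => x; rewrite /W /w; lra.
rewrite WN !(density_step phi_measurable phi_unif).
have sumE c : \sum_(p : {ffun vertex (grid r) -> S})
    \prod_(f : {f : {set vertex (grid r)} | f \in edges (grid r)})
      w c (fun k => p (tnth (edge_tuple f) k)) =
    2^-1 ^+ r.*2 * #|S|%:R ^+ #|vertex (grid r)| + c ^+ r.*2 * state_density u.
  under eq_bigr do rewrite (prod_grid_edges r_ge3)//.
  by rewrite [LHS](state_density_affine l0) -mulr_natr card_ffun natrX.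
have T_lt0 : state_density u < 0 by exact: state_density_kernel_lt0.
have S0 : 0 < #|S|%:R :> R by rewrite ltr0n.
rewrite !sumE card_grid_edges ?(ltnW r_ge3)// -mulrDr.
rewrite expfzDr ?pnatr_eq0// expr1z -exprnN -exprVn.
have -> : (- e) ^+ r.*2 = e ^+ r.*2 by rewrite -mul2n !exprM sqrrN.
apply/negP; rewrite -ltNge.
(* The bound to violate is [2 * c]; after multiplication by [Sn], the two densities fall below it by
   twice the negative term in [eT]. *)
set c := 2^-1 ^+ r.*2; set Sn := #|S|%:R ^+ _.
have -> : #|S|%:R^-1 ^+ #|vertex (grid r)| = Sn^-1 by rewrite exprVn.
have Sn0 : 0 < Sn by rewrite exprn_gt0.
have eT : e ^+ r.*2 * state_density u < 0 by rewrite pmulr_rlt0 ?exprn_gt0.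
by rewrite mulrC ltr_pdivrMr//; lra.
Qed.
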